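(* Let $N\in\mathbb{N}$. For $a, b, c\neq q^{-n}$, $1\leq n\leq N-1$, and $c\neq q^{-N}$, \begin{align*} \sum_{n=1}^{N}\genfrac{[}{]}{0pt}{}{N}{n}\frac{(\frac{b}{a})_{n}(q)_{n}(a)_{N-n}a^{n}}{(1-cq^{n})(b)_n(a)_N}= \sum_{n=1}^{N}\genfrac{[}{]}{0pt}{}{N}{n}\frac{(\frac{b}{c})_{n-1}(q)_n (cq)_{N-n}c^{n-1}}{(b)_{n-1}(cq)_N}\left(\frac{aq^{n-1}}{1-aq^{n-1}}-\frac{bq^{n-1}}{1-bq^{n-1}}\right). \end{align*}
   Context: Here $|q|<1$, $(A)_n=(A;q)_n=(1-A)(1-Aq)\cdots(1-Aq^{n-1})$ with $(A)_0=1$, and $\genfrac{[}{]}{0pt}{}{N}{n}=\frac{(q;q)_N}{(q;q)_n(q;q)_{N-n}}$ for $0\le n\le N$ (and $0$ otherwise) is the $q$-binomial coefficient. *)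

(* Defs.v *)
From mathcomp Require Import all_boot all_order all_algebra.

Set Implicit Arguments.
Unset Strict Implicit.
Unset Printing Implicit Defensive.

Import GRing.Theory.
Local Open Scope ring_scope.

Definition qpoch (F : fieldType) (q A : F) (n : nat) : F :=
  \prod_(i < n) (1 - A * q ^+ i).

Definition qbinom (F : fieldType) (q : F) (N n : nat) : F :=
  if (n <= N)%N then qpoch q q N / (qpoch q q n * qpoch q q (N - n)) else 0.

(* Main.v *)
(** Both sides satisfy the same first-order recurrence
    [(1 - c q^N) S_N(a,b) = (1 - q^N) (a - b) / ((1 - a) (1 - b))
                            + (1 - q^N) (c - b) / (1 - b) * S_(N-1)(aq,bq)],
    with [S_0 = 0].  For the right-hand side this is the splitting off of its
    first term.  For the left-hand side, the factor [1 - c q^n] cancels from the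
    combination [(1 - c q^N) S_N(a,b) - ...], and the remaining sum telescopes. *)
Require Import Defs.
From mathcomp Require Import all_boot all_order all_algebra.
From mathcomp Require Import reals complex.
From mathcomp Require Import ring.

Import Order.TTheory GRing.Theory Num.Theory.
Local Open Scope ring_scope.
Local Open Scope complex_scope.

Section FiniteSums.

Variables (F : fieldType) (q : F).
Implicit Types (a b c A : F) (N n m i : nat).

Lemma qpochS A n : qpoch q A n.+1 = qpoch q A n * (1 - A * q ^+ n).
Proof. by rewrite /qpoch big_ord_recr. Qed.

Lemma qpochSl A n : qpoch q A n.+1 = (1 - A) * qpoch q (A * q) n.
Proof.
rewrite /qpoch big_ord_recl expr0 mulr1; congr (_ * _).
by apply: eq_bigr => i _; rewrite /= exprS mulrA.
Qed.

Lemma qpoch0 A : qpoch q A 0 = 1.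
Proof. by rewrite /qpoch big_ord0. Qed.

Lemma qpoch_neq0 A n :
  (forall i, (i < n)%N -> 1 - A * q ^+ i != 0) -> qpoch q A n != 0.
Proof. by move=> h; apply/prodf_neq0 => i _; apply: h. Qed.

(* [a ^+ n * qpoch q (b / a) n], in a form that also makes sense for [a = 0];
   the induction replaces [a] by [a * q], and [q] may vanish. *)
Definition hpoch a b n : F := \prod_(i < n) (a - b * q ^+ i).

Lemma hpochE a b n : a != 0 -> qpoch q (b / a) n * a ^+ n = hpoch a b n.
Proof.
move=> a0; rewrite -[n in a ^+ n]card_ord -prodr_const -big_split /=.
by apply: eq_bigr => i _; field.
Qed.

Lemma hpochS a b n : hpoch a b n.+1 = hpoch a b n * (a - b * q ^+ n).
Proof. by rewrite /hpoch big_ord_recr. Qed.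

Lemma hpoch0 a b : hpoch a b 0 = 1.
Proof. by rewrite /hpoch big_ord0. Qed.

Lemma hpochSl a b n : hpoch a b n.+1 = (a - b) * hpoch a (b * q) n.
Proof.
rewrite /hpoch big_ord_recl expr0 mulr1; congr (_ * _).
by apply: eq_bigr => i _; rewrite /= exprS mulrA.
Qed.

Lemma hpochM a b n : hpoch (a * q) (b * q) n = q ^+ n * hpoch a b n.
Proof.
rewrite /hpoch -[n in q ^+ n]card_ord -prodr_const -big_split /=.
by apply: eq_bigr => i _; ring.
Qed.

(** The left-hand summand without its denominator [1 - c * q ^+ n], kept apart because it is the
    factor that will cancel. The q-binomial times [qpoch q q n] is already reduced. *)
Definition lcoef N a b n : F :=
  qpoch q q N / qpoch q q (N - n) * hpoch a b n * qpoch q a (N - n)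
  / (qpoch q b n * qpoch q a N).

(** The right-hand summand at [n = i.+1]. *)
Definition rterm N a b c i : F :=
  qpoch q q N / qpoch q q (N - i.+1) * hpoch c b i * qpoch q (c * q) (N - i.+1)
  / (qpoch q b i * qpoch q (c * q) N)
  * (a * q ^+ i / (1 - a * q ^+ i) - b * q ^+ i / (1 - b * q ^+ i)).

Definition lsum N a b c : F :=
  \sum_(0 <= i < N) lcoef N a b i.+1 / (1 - c * q ^+ i.+1).

Definition rsum N a b c : F := \sum_(0 <= i < N) rterm N a b c i.

(** The only consequence of [|q| < 1] that the algebra uses. *)
Hypothesis q_not_root1 : forall i, 1 - q * q ^+ i != 0.

Lemma qpochqq_neq0 n : qpoch q q n != 0.
Proof. by apply: qpoch_neq0 => i _; apply: q_not_root1. Qed.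

(** Raising both [N] and [i] preserves [N - i.+1], and the bracket depends only on [a * q ^+ i.+1]
    and [b * q ^+ i.+1]. So only the leading factors of the products in [b] and the last factors of
    those of length [N.+1] come out. *)
Lemma rterm_shift N a b c i :
  (i < N)%N ->
  (forall k, (k < N.+1)%N -> 1 - b * q ^+ k != 0) ->
  (forall k, (k < N.+1)%N -> 1 - c * q * q ^+ k != 0) ->
  rterm N.+1 a b c i.+1 =
  (1 - q ^+ N.+1) * (c - b) / ((1 - b) * (1 - c * q ^+ N.+1))
  * rterm N (a * q) (b * q) c i.
Proof.
move=> iN hb hc; rewrite /rterm subSS -!(mulrA _ q (q ^+ i)) -!exprS.
set D := (_ / _ - _ / _).
rewrite (qpochSl b) hpochSl (qpochS q) (qpochS (c * q)) -!mulrA -!exprS !mulrA.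
have b1 : 1 - b != 0 by have := hb 0%N isT; rewrite mulr1.
have bi : qpoch q (b * q) i != 0.
  apply: qpoch_neq0 => k ki; rewrite -mulrA -exprS.
  by apply: hb; rewrite ltnS (leq_trans ki) // ltnW.
have cN : qpoch q (c * q) N != 0.
  by apply: qpoch_neq0 => k kN; apply: hc; rewrite ltnS ltnW.
have cN1 : 1 - c * q ^+ N.+1 != 0 by rewrite exprS mulrA; apply: hc.
have q0 := qpochqq_neq0 (N - i.+1).
by field; rewrite ?b1 ?bi ?cN ?cN1 ?q0.
Qed.

Lemma rsum_rec N a b c :
  (forall k, (k < N.+1)%N -> 1 - a * q ^+ k != 0) ->
  (forall k, (k < N.+1)%N -> 1 - b * q ^+ k != 0) ->
  (forall k, (k < N.+1)%N -> 1 - c * q * q ^+ k != 0) ->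
  rsum N.+1 a b c =
  ((1 - q ^+ N.+1) * (a - b) / ((1 - a) * (1 - b))
   + (1 - q ^+ N.+1) * (c - b) / (1 - b) * rsum N (a * q) (b * q) c)
  / (1 - c * q ^+ N.+1).
Proof.
move=> ha hb hc; rewrite /rsum big_nat_recl //.
rewrite (eq_big_nat _ _ (fun i iN => rterm_shift N a b c i (andP iN).2 hb hc)).
rewrite -mulr_sumr; set S := \sum_(_ <= _ < _) _.
have a1 : 1 - a != 0 by have := ha 0%N isT; rewrite mulr1.
have b1 : 1 - b != 0 by have := hb 0%N isT; rewrite mulr1.
have cN : qpoch q (c * q) N != 0.
  by apply: qpoch_neq0 => k kN; apply: hc; rewrite ltnS ltnW.
have cN1 : 1 - c * q ^+ N.+1 != 0 by rewrite exprS mulrA; apply: hc.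
have q0 := qpochqq_neq0 N.
rewrite /rterm hpoch0 qpoch0 subSS subn0 !qpochS -[c * q * _]mulrA -!exprS expr0.
by field; rewrite ?a1 ?b1 ?cN ?cN1 ?q0.
Qed.

(* The antidifference, found by absorbing one more factor of [qpoch q a]. *)
Definition tele N a b n : F :=
  qpoch q q N / qpoch q q (N - n) * hpoch a b n * qpoch q a (N - n).+1
  / (qpoch q b n * qpoch q a N).

(** With L = [lcoef N.+1 a b n], the shifted term equals L (q^n - q^(N+1)) (c - b) / (1 - b q^n)
    before division by 1 - c q^n. Since (1 - c q^(N+1)) (1 - b q^n) - (q^n - q^(N+1)) (c - b) = (1 -
    c q^n) (1 - b q^(N+1)), the difference is L (1 - b q^(N+1)) / (1 - b q^n), free of [c]; this is
    the difference of [tele] over 1 - a. *)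
Lemma lcoef_tele N a b c n :
  (n <= N)%N ->
  (forall k, (k < N.+1)%N -> 1 - a * q ^+ k != 0) ->
  (forall k, (k < N.+1)%N -> 1 - b * q ^+ k != 0) ->
  1 - c * q ^+ n != 0 ->
  (1 - c * q ^+ N.+1) * (lcoef N.+1 a b n / (1 - c * q ^+ n)) =
  (1 - q ^+ N.+1) * (c - b) / (1 - b)
    * (lcoef N (a * q) (b * q) n / (1 - c * q ^+ n))
  + (tele N.+1 a b n - tele N.+1 a b n.+1) / (1 - a).
Proof.
move=> nN ha hb cn; rewrite /lcoef /tele !subSS subSn //.
have a1 : 1 - a != 0 by have := ha 0%N isT; rewrite mulr1.
have b1 : 1 - b != 0 by have := hb 0%N isT; rewrite mulr1.
have bn1 : 1 - b * q ^+ n != 0 by apply: hb; rewrite ltnS.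
have bn : qpoch q b n != 0.
  by apply: qpoch_neq0 => k kn; apply: hb; rewrite ltnS (leq_trans (ltnW kn)).
have aqN : qpoch q (a * q) N != 0.
  by apply: qpoch_neq0 => k kN; rewrite -mulrA -exprS; apply: ha; rewrite ltnS.
have qm := qpochqq_neq0 (N - n).
have qm1 := q_not_root1 (N - n).
have -> : qpoch q (b * q) n = qpoch q b n * (1 - b * q ^+ n) / (1 - b).
  by rewrite -qpochS qpochSl mulrAC mulfV ?mul1r.
(* [field] takes these powers as independent atoms, so their one relation is substituted
   beforehand. *)
have EN : q ^+ N.+1 = q * q ^+ (N - n) * q ^+ n.
  by rewrite -mulrA -exprD subnK // exprS.
rewrite (qpochSl a N) (qpochS a (N - n).+1) (qpochSl a (N - n)) hpochM hpochS.
rewrite (qpochS b) (qpochS q N) (qpochS q (N - n)) -[q * q ^+ N]exprS EN exprS.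
by field; rewrite ?a1 ?b1 ?bn1 ?bn ?aqN ?qm ?qm1 ?cn.
Qed.

Lemma lsum_rec N a b c :
  (forall k, (k < N.+1)%N -> 1 - a * q ^+ k != 0) ->
  (forall k, (k < N.+1)%N -> 1 - b * q ^+ k != 0) ->
  (forall k, (k < N.+1)%N -> 1 - c * q * q ^+ k != 0) ->
  lsum N.+1 a b c =
  ((1 - q ^+ N.+1) * (a - b) / ((1 - a) * (1 - b))
   + (1 - q ^+ N.+1) * (c - b) / (1 - b) * lsum N (a * q) (b * q) c)
  / (1 - c * q ^+ N.+1).
Proof.
move=> ha hb hc.
have a1 : 1 - a != 0 by have := ha 0%N isT; rewrite mulr1.
have b1 : 1 - b != 0 by have := hb 0%N isT; rewrite mulr1.
have hc' k : (k < N.+1)%N -> 1 - c * q ^+ k.+1 != 0.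
  by move=> kN; rewrite exprS mulrA; apply: hc.
have cN1 := hc' N (ltnSn N).
apply: (mulfI cN1); rewrite [RHS]mulrC divfK // /lsum big_nat_recr //= mulrDr.
rewrite mulr_sumr.
rewrite (eq_big_nat _ _ (fun i iN => lcoef_tele N a b c i.+1 (andP iN).2 ha hb
   (hc' i (leqW (andP iN).2)))).
rewrite big_split /= -mulr_sumr -mulr_suml [RHS]addrC -addrA; congr (_ + _).
rewrite [\sum_(_ <= _ < _) _](eq_bigr
  (fun i => - (tele N.+1 a b i.+2 - tele N.+1 a b i.+1))); last first.
  by move=> i _; rewrite opprB.
rewrite sumrN (telescope_sumr (fun i => tele N.+1 a b i.+1)) // opprB.
(* The last summand is kept apart: [1 - b * q ^+ N.+1] may vanish. *)
have -> : (1 - c * q ^+ N.+1) * (lcoef N.+1 a b N.+1 / (1 - c * q ^+ N.+1))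
          = tele N.+1 a b N.+1 / (1 - a).
  rewrite mulrC divfK // /lcoef /tele subnn (qpochS a 0) !qpoch0 expr0.
  by rewrite mul1r !mulr1 [RHS]mulrAC mulfK.
(* The two boundary values at [N.+1] cancel; [tele] at 1 gives the inhomogeneous term. *)
rewrite -mulrDl subrK /tele subSS subn0.
have aN : qpoch q a N.+1 != 0 by apply: qpoch_neq0.
have q0 := qpochqq_neq0 N.
rewrite hpochS hpoch0 !(qpochS q) (qpochS b) qpoch0 -exprS expr0.
by field; rewrite ?a1 ?b1 ?aN ?q0.
Qed.

Lemma lsum_rsum N a b c :
  (forall k, (k < N)%N -> 1 - a * q ^+ k != 0) ->
  (forall k, (k < N)%N -> 1 - b * q ^+ k != 0) ->
  (forall k, (k < N)%N -> 1 - c * q * q ^+ k != 0) ->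
  lsum N a b c = rsum N a b c.
Proof.
elim: N a b => [|N IHN] a b ha hb hc; first by rewrite /lsum /rsum !big_nil.
rewrite lsum_rec // rsum_rec // IHN // => k kN; rewrite -?(mulrA _ q) -?exprS.
- exact: ha.
- exact: hb.
- by rewrite exprS mulrA; apply: hc; apply: ltnW.
Qed.

Lemma qbinomM_qpoch N n :
  (n <= N)%N -> qbinom q N n * qpoch q q n = qpoch q q N / qpoch q q (N - n).
Proof.
move=> nN; rewrite /qbinom nN.
by field; rewrite !qpochqq_neq0.
Qed.

End FiniteSums.

(** If [A * q ^+ n = 1], then [q ^+ n] is invertible, so the convention for the inverse of 0 does
    not interfere when [q = 0]. *)
Lemma one_subMX_neq0 (F : fieldType) (q A : F) n :
  A != q ^- n -> 1 - A * q ^+ n != 0.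
Proof.
apply: contraNneq => /eqP; rewrite subr_eq0 eq_sym => /eqP e.
have q0 : q ^+ n != 0.
  by apply/eqP => z; move: e; rewrite z mulr0; apply/eqP; rewrite eq_sym oner_eq0.
by apply/eqP/(mulIf q0); rewrite e mulVf.
Qed.

Theorem theorem1p1 (R : realType) (q a b c : R[i]) (N : nat)
  (hq : `|q| < 1)
  (a_neq0 : a != 0) (c_neq0 : c != 0)
  (a_neq1 : a != 1) (b_neq1 : b != 1)
  (habc : forall n : nat, (1 <= n <= N - 1)%N ->
     [/\ a != q ^- n, b != q ^- n & c != q ^- n])
  (hcN : c != q ^- N) :
  \sum_(1 <= n < N.+1)
     qbinom q N n *
     ((qpoch q (b / a) n * qpoch q q n * qpoch q a (N - n) * a ^+ n) /
      ((1 - c * q ^+ n) * qpoch q b n * qpoch q a N))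
  =
  \sum_(1 <= n < N.+1)
     qbinom q N n *
     ((qpoch q (b / c) (n - 1) * qpoch q q n * qpoch q (c * q) (N - n)
         * c ^+ (n - 1)) /
      (qpoch q b (n - 1) * qpoch q (c * q) N)) *
     (a * q ^+ (n - 1) / (1 - a * q ^+ (n - 1))
      - b * q ^+ (n - 1) / (1 - b * q ^+ (n - 1))).
Proof.
have q_not_root1 i : 1 - q * q ^+ i != 0.
  rewrite -exprS subr_eq0 eq_sym; apply/eqP => e.
  have : `|q| ^+ i.+1 < 1 by rewrite exprn_ilt1.
  by rewrite -normrX e normr1 ltxx.
have ha k : (k < N)%N -> 1 - a * q ^+ k != 0.
  (* [habc] starts at exponent 1; exponent 0 is [a_neq1]. *)
  case: k => [|k] kN; first by rewrite mulr1 subr_eq0 eq_sym.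
  apply: one_subMX_neq0.
  by have [] := habc k.+1 _ => //; rewrite /= leq_subRL ?add1n // (leq_trans _ kN).
have hb k : (k < N)%N -> 1 - b * q ^+ k != 0.
  case: k => [|k] kN; first by rewrite mulr1 subr_eq0 eq_sym.
  apply: one_subMX_neq0.
  by have [] := habc k.+1 _ => //; rewrite /= leq_subRL ?add1n // (leq_trans _ kN).
have hc k : (k < N)%N -> 1 - c * q * q ^+ k != 0.
  move=> kN; rewrite -mulrA -exprS; apply: one_subMX_neq0.
  (* For [c] the exponents run from 1 to [N], the last one being covered by [hcN]. *)
  move: kN; rewrite leq_eqVlt => /predU1P[->//|kN].
  by have [] := habc k.+1 _ => //; rewrite /= leq_subRL ?add1n // (leq_trans _ kN).
have := lsum_rsum _ _ q_not_root1 _ _ _ _ ha hb hc.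
rewrite /lsum /rsum !big_add1 /= => E.
(* Returning from [hpoch] to the quotients [b / a] and [b / c] is where [a] and [c] must be
   nonzero. *)
etransitivity; first etransitivity; [|exact: E|].
  apply: eq_big_nat => i /andP[_ iN].
  rewrite /lcoef -(qbinomM_qpoch _ _ q_not_root1) // -hpochE // !invfM; ring.
apply: eq_big_nat => i /andP[_ iN].
rewrite /rterm -(qbinomM_qpoch _ _ q_not_root1) // subn1 /= -hpochE //.
congr (_ * _); rewrite !invfM; ring.
Qed.
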